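(* Let $(\mathfrak{q},\beta)$ be a finite dimensional real quasi-Frobenius Lie algebra, let $G$ be a Lie group with Lie algebra $\mathfrak{g}$, and let $$\rho: G\rightarrow \mathrm{Aut}(\mathfrak{q},\beta)\subset GL(\mathfrak{q}),\quad g\mapsto \rho_g$$ be a Lie group homomorphism. Define $$\rho':=\rho_{\ast,e}: \mathfrak{g}\rightarrow \mathfrak{gl}(\mathfrak{q}),\quad x\mapsto \rho'_x.$$ Then $(\mathfrak{q},\beta,\rho')$ is a $\mathfrak{g}$-quasi-Frobenius Lie algebra. In particular, if $G$ is any Lie subgroup of $\mathrm{Aut}(\mathfrak{q},\beta)$, then $(\mathfrak{q},\beta)$ admits the structure of a $\mathfrak{g}$-quasi-Frobenius Lie algebra.
   Context: Lie groups are real and finite dimensional; $e$ denotes the identity. A quasi-Frobenius Lie algebra (over $\mathbb{R}$) is a pair $(\mathfrak{q},\beta)$ with $\mathfrak{q}$ a Lie algebra and $\beta$ a nondegenerate skew-symmetric bilinear form on $\mathfrak{q}$ with $\beta([u,v],w)+\beta([v,w],u)+\beta([w,u],v)=0$ for all $u,v,w$. $\mathrm{Aut}(\mathfrak{q},\beta)$ is the group of Lie algebra automorphisms $\psi$ of $\mathfrak{q}$ with $\beta(\psi(u),\psi(v))=\beta(u,v)$ for all $u,v$; it is a closed, hence embedded Lie, subgroup of $GL(\mathfrak{q})$. A $\mathfrak{g}$-quasi-Frobenius Lie algebra is a triple $(\mathfrak{q},\beta,\rho)$ with $(\mathfrak{q},\beta)$ quasi-Frobenius and $\rho:\mathfrak{g}\to\mathfrak{gl}(\mathfrak{q})$,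 $x\mapsto\rho_x$, a representation such that each $\rho_x$ is a derivation of $\mathfrak{q}$ and $\beta(\rho_x(u),v)+\beta(u,\rho_x(v))=0$ for all $x\in\mathfrak{g}$, $u,v\in\mathfrak{q}$. *)

(* Defs.v *)
From HB Require Import structures.
From mathcomp Require Import all_boot all_order all_algebra sesquilinear.
From mathcomp Require Import ring.
From mathcomp Require Import all_classical all_reals all_analysis.

Set Implicit Arguments.
Unset Strict Implicit.
Unset Printing Implicit Defensive.

Import Order.TTheory GRing.Theory Num.Theory.
Import numFieldNormedType.Exports.

Local Open Scope classical_set_scope.
Local Open Scope ring_scope.

Section calculus.
Context {R : realType}.

(* On an open subset U of a finite dimensional space this is the usual class C^k;
   taking all directional derivatives avoids choosing coordinates on V. *)
Fixpoint Ck (k : nat) {V W : normedModType R} (U : set V) (f : V -> W) : Prop :=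
  if k is k'.+1 then
    (forall x, U x -> differentiable f x) /\ (forall v, Ck k' U ('D_v f))
  else forall x, U x -> {for x, continuous f}.

Definition smooth_on {V W : normedModType R} (U : set V) (f : V -> W) :=
  forall k, Ck k U f.

Lemma near_eq_differentiable {V W : normedModType R} (f g : V -> W) (x : V) :
  {near x, f =1 g} -> differentiable f x -> differentiable g x.
Proof.
move=> fg df.
have eg : g \o shift x = cst (g x) + 'd f x +o_ 0 id.
  apply/eqaddoP => e e0.
  have /eqaddoP /(_ _ e0) := diff_locally df.
  have fg0 : \forall h \near 0, f (h + x) = g (h + x).
    have : \forall y \near x, f y = g y by [].
    rewrite [\forall y \near x, _ = _](near_shift 0) subr0 => fg0.
    by near=> h; near: h.
  move=> eh; near=> h.
  have : `|(f \o shift x - (cst (f x) + 'd f x)) h| <= e * `|h| by near: h.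
  rewrite !fctE /= (nbhs_singleton fg).
  by have -> : f (h + x) = g (h + x) by near: h.
have dc := diff_continuous df.
have dg : 'd g x = 'd f x :> (V -> W) by exact: diff_unique.
apply/diff_locallyP; rewrite dg; split => //.
Unshelve. all: by end_near. Qed.

Lemma Ck_eq k {V W : normedModType R} (U : set V) (f g : V -> W) :
  open U -> (forall x, U x -> f x = g x) -> Ck k U f -> Ck k U g.
Proof.
move=> oU; elim: k f g => [|k IH] f g fg.
  move=> cf x Ux.
  have nfg : {near x, f =1 g}.
    by near=> y; apply: fg; near: y; exact: open_nbhs_nbhs.
  rewrite /prop_for /continuous_at -(fg _ Ux).
  by apply: cvg_trans (cf x Ux); exact: near_eq_cvg.
move=> [df cf].
have nfg x : U x -> {near x, f =1 g}.
  by move=> Ux; near=> y; apply: fg; near: y; exact: open_nbhs_nbhs.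
split=> [x Ux|v]; first exact: near_eq_differentiable (nfg x Ux) (df x Ux).
apply: IH (cf v) => x Ux; exact: near_eq_derive (nfg x Ux).
Unshelve. all: by end_near. Qed.

Lemma CkW k {V W : normedModType R} (U : set V) (f : V -> W) :
  Ck k.+1 U f -> Ck k U f.
Proof.
elim: k f => [|k IH] f [df cf]; first by move=> x /df/differentiable_continuous.
by split=> // v; apply: IH.
Qed.

Lemma Ck_cst k {V W : normedModType R} (U : set V) (a : W) :
  open U -> Ck k U (cst a : V -> W).
Proof.
move=> oU; elim: k a => [|k IH] a; first by move=> x _; exact: cst_continuous.
split=> [x _|v]; first exact: differentiable_cst.
by apply: (Ck_eq oU) (IH 0) => x _; rewrite derive_cst.
Qed.

Lemma CkD k {V W : normedModType R} (U : set V) (f g : V -> W) :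
  open U -> Ck k U f -> Ck k U g -> Ck k U (f + g).
Proof.
move=> oU; elim: k f g => [|k IH] f g.
  by move=> cf cg x Ux; apply: cvgD; [exact: cf|exact: cg].
move=> [df cf] [dg cg]; split=> [x Ux|v].
  by apply: differentiableD; [exact: df|exact: dg].
apply: (Ck_eq oU) (IH _ _ (cf v) (cg v)) => x Ux.
by rewrite deriveD//; apply: diff_derivable; [exact: df|exact: dg].
Qed.

Lemma CkM k {V : normedModType R} (U : set V) (f g : V -> R) :
  open U -> Ck k U f -> Ck k U g -> Ck k U (f * g).
Proof.
move=> oU; elim: k f g => [|k IH] f g.
  by move=> cf cg x Ux; apply: cvgM; [exact: cf|exact: cg].
move=> fS gS; have [df cf] := fS; have [dg cg] := gS; split=> [x Ux|v].
  by apply: differentiableM; [exact: df|exact: dg].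
apply: (Ck_eq oU)
  (CkD oU (IH _ _ (CkW fS) (cg v)) (IH _ _ (CkW gS) (cf v))) => x Ux.
by rewrite deriveM//; apply: diff_derivable; [exact: df|exact: dg].
Qed.

Lemma Ck_entry k {V : normedModType R} {m p : nat} (U : set V)
    (f : V -> 'M[R]_(m, p)) i j :
  open U -> Ck k U f -> Ck k U (fun x => f x i j).
Proof.
move=> oU; elim: k f => [|k IH] f.
  move=> cf x Ux; apply: (@continuous_comp _ _ _ f (fun M => M i j)).
    exact: cf.
  exact: coord_continuous.
move=> [df cf]; split=> [x Ux|v].
  apply: (@differentiable_comp _ _ _ _ f (fun M => M i j)); first exact: df.
  exact: differentiable_coord.
apply: (Ck_eq oU) (IH _ (cf v)) => x Ux.
by rewrite derive_mx ?mxE//; apply: diff_derivable; exact: df.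
Qed.

End calculus.

(* A chart with values in E is given by total functions [cmap] and [cinv],
   which are only meaningful on [cdom] and on [cimg] respectively. *)
Record chart (R : realType) (M : topologicalType) (E : normedModType R) :=
  Chart { cdom : set M; cmap : M -> E; cinv : E -> M }.

Section charts.
Context {R : realType}.

Definition cimg {M : topologicalType} {E : normedModType R} (c : chart M E) :
  set E := cmap c @` cdom c.

Definition is_chart {M : topologicalType} {E : normedModType R}
    (c : chart M E) : Prop :=
  [/\ open (cdom c), open (cimg c),
      forall x, cdom c x -> cinv c (cmap c x) = x,
      forall x, cdom c x -> {for x, continuous (cmap c)} &
      forall y, cimg c y -> {for y, continuous (cinv c)}].

Definition compatible {M : topologicalType} {E : normedModType R}
    (c d : chart M E) : Prop :=
  smooth_on (cimg c `&` cinv c @^-1` cdom d) (cmap d \o cinv c).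

Definition vec_atlas (E : normedModType R) : set (chart E E) :=
  [set Chart setT id id].

Definition prod_chart {M N : topologicalType} {E F : normedModType R}
    (c : chart M E) (d : chart N F) : chart (M * N)%type (E * F)%type :=
  Chart (cdom c `*` cdom d) (fun p => (cmap c p.1, cmap d p.2))
    (fun p => (cinv c p.1, cinv d p.2)).

Definition prod_atlas {M N : topologicalType} {E F : normedModType R}
    (A : set (chart M E)) (B : set (chart N F)) :
    set (chart (M * N)%type (E * F)%type) :=
  [set e | exists2 c, A c & exists2 d, B d & e = prod_chart c d].

Definition smooth_map {M N : topologicalType} {E F : normedModType R}
    (A : set (chart M E)) (B : set (chart N F)) (f : M -> N) : Prop :=
  continuous f /\ forall c d, A c -> B d ->
    smooth_on (cimg c `&` (f \o cinv c) @^-1` cdom d)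
      (cmap d \o f \o cinv c).

End charts.

Arguments vec_atlas {R} E _.

(* Smooth manifolds of dimension n; the atlas is not required to be maximal, it
   stands for the smooth structure that it generates. *)
HB.mixin Record isManifold (R : realType) (n : nat) M of Topological M := {
  atlas : set (chart M 'rV[R]_n);
  atlas_is_chart : forall c, atlas c -> is_chart c;
  atlas_cover : forall x, exists2 c, atlas c & cdom c x;
  atlas_compatible : forall c d, atlas c -> atlas d -> compatible c d;
  manifold_hausdorff : hausdorff_space M;
  manifold_second_countable : @second_countable M
}.

#[short(type="manifoldType")]
HB.structure Definition Manifold (R : realType) (n : nat) :=
  {M of isManifold R n M & Topological M}.

Arguments atlas {R n}.

HB.mixin Record isLieGroup (R : realType) (n : nat) G
    of Manifold R n G & Group G := {
  smooth_mulg : smooth_map (prod_atlas (atlas G) (atlas G)) (atlas G)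
    (fun p : G * G => (p.1 * p.2)%g);
  smooth_invg : smooth_map (atlas G) (atlas G) (fun x : G => (x^-1)%g)
}.

#[short(type="lieGroupType")]
HB.structure Definition LieGroup (R : realType) (n : nat) :=
  {G of isLieGroup R n G & Manifold R n G & Group G}.

Section smooth_functions.
Context {R : realType} {n : nat} (M : manifoldType R n).

Definition smooth_fun : {pred M -> R} :=
  fun f => `[< smooth_map (atlas M) (vec_atlas R) f >].

Lemma smooth_funP (f : M -> R) : f \in smooth_fun <->
  continuous f /\ forall c, atlas M c -> smooth_on (cimg c) (f \o cinv c).
Proof.
split=> [/asboolP[cf sf]|[cf sf]].
  split=> // c cA; have := sf c _ cA erefl.
  by rewrite /= preimage_setT setIT.
by apply/asboolP; split=> // c _ cA -> /=; rewrite preimage_setT setIT; exact: sf.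
Qed.

Lemma open_cimg c : atlas M c -> open (cimg c).
Proof. by move=> /atlas_is_chart[]. Qed.

Lemma smooth_fun_cst (a : R) : (cst a : M -> R) \in smooth_fun.
Proof.
apply/smooth_funP; split=> [x|c cA k]; first exact: cst_continuous.
exact: Ck_cst (open_cimg cA).
Qed.

Lemma smooth_funD (f g : M -> R) :
  f \in smooth_fun -> g \in smooth_fun -> f + g \in smooth_fun.
Proof.
move=> /smooth_funP[cf sf] /smooth_funP[cg sg]; apply/smooth_funP.
split=> [x|c cA k]; first by apply: cvgD; [exact: cf|exact: cg].
by apply: (CkD (open_cimg cA)); [exact: sf|exact: sg].
Qed.

Lemma smooth_funM (f g : M -> R) :
  f \in smooth_fun -> g \in smooth_fun -> f * g \in smooth_fun.
Proof.
move=> /smooth_funP[cf sf] /smooth_funP[cg sg]; apply/smooth_funP.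
split=> [x|c cA k]; first by apply: cvgM; [exact: cf|exact: cg].
by apply: (CkM (open_cimg cA)); [exact: sf|exact: sg].
Qed.

Lemma smooth_funZ a (f : M -> R) : f \in smooth_fun -> a *: f \in smooth_fun.
Proof. by move=> sf; apply: smooth_funM (smooth_fun_cst a) sf. Qed.

Lemma smooth_fun_subring : subring_closed smooth_fun.
Proof.
split=> [|f g sf sg|]; first exact: smooth_fun_cst; last exact: smooth_funM.
by apply: smooth_funD => //; rewrite -scaleN1r; apply: smooth_funZ.
Qed.
HB.instance Definition _ :=
  GRing.isSubringClosed.Build (M -> R) smooth_fun smooth_fun_subring.
HB.instance Definition _ :=
  GRing.isScaleClosed.Build R (M -> R) smooth_fun smooth_funZ.

Record Cinfty := MkCinfty {
  Cinfty_val :> M -> R;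
  _ : Cinfty_val \in smooth_fun }.

HB.instance Definition _ := [isSub for Cinfty_val].
HB.instance Definition _ := [Choice of Cinfty by <:].
HB.instance Definition _ := 
  GRing.SubChoice_isSubComPzRing.Build _ _ Cinfty (subringClosedP _).
HB.instance Definition _ := [SubZmodule_isSubLmodule of Cinfty by <:].

Lemma CinftyE : ((forall (f g : Cinfty) x, (f + g)%R x = (f x + g x)%R) *
  (forall (f g : Cinfty) x, (f * g)%R x = (f x * g x)%R) *
  (forall (f : Cinfty) x, (- f)%R x = (- f x)%R) *
  (forall a (f : Cinfty) x, (a *: f)%R x = (a * f x)%R) *
  (forall x, (0%R : Cinfty) x = 0%R) * (forall f : Cinfty, \val f = f))%type.
Proof. by []. Qed.

End smooth_functions.

HB.mixin Record isLieAlgebra (R : comNzRingType) L of GRing.Lmodule R L := {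
  lie : L -> L -> L;
  lie_linearl : forall v, linear (lie^~ v);
  lie_linearr : forall u, linear (lie u);
  liexx : forall u, lie u u = 0;
  lie_jacobi : forall u v w,
    lie u (lie v w) + lie v (lie w u) + lie w (lie u v) = 0
}.

#[short(type="lieAlgType")]
HB.structure Definition LieAlgebra (R : comNzRingType) :=
  {L of isLieAlgebra R L & GRing.Lmodule R L}.

#[short(type="finLieAlgType")]
HB.structure Definition FinLieAlgebra (R : comNzRingType) :=
  {L of isLieAlgebra R L & Vector R L}.

Section tangent.
Context {R : realType} {n : nat} {M : manifoldType R n} (p : M).

Definition derivation_at : {pred Cinfty M -> R^o} :=
  fun v => `[< scalar v /\ forall f g, v (f * g) = v f * g p + f p * v g >].

Lemma derivation_at_submod : submod_closed derivation_at.
Proof.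
split=> [|a v w /asboolP[lv dv] /asboolP[lw dw]]; apply/asboolP.
  have z f : (0 : Cinfty M -> R^o) f = 0 by [].
  by split=> [b f g|f g]; rewrite !z; ring.
have E f : (a *: v + w) f = a * v f + w f by [].
by split=> [b f g|f g]; rewrite !E ?lv ?lw ?dv ?dw /=; ring.
Qed.
HB.instance Definition _ := GRing.isSubmodClosed.Build R (Cinfty M -> R^o)
  derivation_at (GRing.submod_closed_semi derivation_at_submod).

Record tangent := MkTangent {
  tangent_val :> Cinfty M -> R;
  _ : tangent_val \in derivation_at }.

HB.instance Definition _ := [isSub for tangent_val].
HB.instance Definition _ := [Choice of tangent by <:].
HB.instance Definition _ := [SubChoice_isSubLmodule of tangent by <:].

End tangent.

Section lie_algebra_of_lie_group.
Context {R : realType} {n : nat} (G : lieGroupType R n).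

(* Vector fields are encoded as the derivations of the algebra of smooth functions;
   [h] below is the left translate of [f] by [a], which is always smooth. *)
Definition left_invariant_field : {pred Cinfty G -> Cinfty G} :=
  fun X => `[< [/\ linear X,
    forall f g, X (f * g) = X f * g + f * X g &
    forall (a : G) (f h : Cinfty G), (forall x, h x = f (a * x)%g) ->
      forall x, X h x = X f (a * x)%g] >].

Lemma left_invariant_field_submod : submod_closed left_invariant_field.
Proof.
split=> [|a X Y /asboolP[lX dX iX] /asboolP[lY dY iY]]; apply/asboolP.
  have z f : (0 : Cinfty G -> Cinfty G) f = 0 by [].
  by split=> [b f g|f g|b f h _ x]; rewrite !z ?scaler0 ?mul0r ?mulr0 ?addr0.
have E f : (a *: X + Y) f = a *: X f + Y f by [].
split=> [b f g|f g|b f h hf x]; rewrite !E.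
- rewrite lX lY; apply/val_inj/funext => x.
  by rewrite !CinftyE; ring.
- rewrite dX dY; apply/val_inj/funext => x.
  by rewrite !CinftyE; ring.
- by rewrite !CinftyE (iX _ _ _ hf) (iY _ _ _ hf).
Qed.
HB.instance Definition _ := GRing.isSubmodClosed.Build R (Cinfty G -> Cinfty G)
  left_invariant_field (GRing.submod_closed_semi left_invariant_field_submod).

Record lie_of := MkLieOf {
  lie_of_val :> Cinfty G -> Cinfty G;
  _ : lie_of_val \in left_invariant_field }.

HB.instance Definition _ := [isSub for lie_of_val].
HB.instance Definition _ := [Choice of lie_of by <:].
HB.instance Definition _ := [SubChoice_isSubLmodule of lie_of by <:].

Lemma lie_ofP (X : lie_of) : [/\ linear X,
    forall f g, X (f * g) = X f * g + f * X g &
    forall (a : G) (f h : Cinfty G), (forall x, h x = f (a * x)%g) ->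
      forall x, X h x = X f (a * x)%g].
Proof. by case: X => X /= /asboolP. Qed.

Lemma lie_ofE : ((forall (X Y : lie_of) f, (X + Y)%R f = (X f + Y f)%R) *
  (forall a (X : lie_of) f, (a *: X)%R f = (a *: X f)%R) *
  (forall f, (0%R : lie_of) f = 0%R) * (forall X : lie_of, \val X = X))%type.
Proof. by []. Qed.

Definition commutator (X Y : lie_of) : Cinfty G -> Cinfty G :=
  fun f => X (Y f) - Y (X f).

Lemma lie_of_linear (X : lie_of) : linear X. Proof. by case: (lie_ofP X). Qed.

Lemma lie_ofB (X : lie_of) f g : X (f - g) = X f - X g.
Proof. by rewrite addrC -scaleN1r lie_of_linear scaleN1r addrC. Qed.

Lemma commutator_left_invariant X Y : commutator X Y \in left_invariant_field.
Proof.
have [lX dX iX] := lie_ofP X; have [lY dY iY] := lie_ofP Y.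
apply/asboolP; rewrite /commutator; split.
- move=> b f g; rewrite lX lY lX lY; apply/val_inj/funext => x.
  by rewrite !CinftyE; ring.
- have XD f g : X (f + g) = X f + X g by rewrite -[f]scale1r lX !scale1r.
  have YD f g : Y (f + g) = Y f + Y g by rewrite -[f]scale1r lY !scale1r.
  move=> f g; rewrite dX dY XD YD !dX !dY; ring.
- move=> a f h hf x; rewrite !CinftyE.
  by rewrite (iX a (Y f) (Y h) (iY _ _ _ hf)) (iY a (X f) (X h) (iX _ _ _ hf)).
Qed.

Definition lie_of_bracket X Y : lie_of :=
  MkLieOf (commutator_left_invariant X Y).

Let bracket_linearl Y : linear (lie_of_bracket^~ Y).
Proof.
move=> a X X'; apply/val_inj/funext => f; rewrite !lie_ofE /= /commutator !lie_ofE.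
rewrite lie_of_linear; apply/val_inj/funext => x.
by rewrite !CinftyE; ring.
Qed.

Let bracket_linearr X : linear (lie_of_bracket X).
Proof.
move=> a Y Y'; apply/val_inj/funext => f; rewrite !lie_ofE /= /commutator !lie_ofE.
rewrite lie_of_linear; apply/val_inj/funext => x.
by rewrite !CinftyE; ring.
Qed.

Let bracketxx X : lie_of_bracket X X = 0.
Proof. by apply/val_inj/funext => f /=; rewrite /commutator subrr. Qed.

Let bracket_jacobi X Y Z :
  lie_of_bracket X (lie_of_bracket Y Z) + lie_of_bracket Y (lie_of_bracket Z X)
    + lie_of_bracket Z (lie_of_bracket X Y) = 0.
Proof.
apply/val_inj/funext => f; rewrite !lie_ofE /= /commutator /= /commutator.
by rewrite !lie_ofB; ring.
Qed.

HB.instance Definition _ := isLieAlgebra.Build R lie_of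
  bracket_linearl bracket_linearr bracketxx bracket_jacobi.

Lemma lie_of_at_e (X : lie_of) :
  (fun f : Cinfty G => X f 1%g) \in derivation_at (1%g : G).
Proof.
have [lX dX _] := lie_ofP X; apply/asboolP; split.
  by move=> a f g; rewrite lX.
by move=> f g; rewrite dX.
Qed.

Definition at_e (X : lie_of) : tangent (1%g : G) := MkTangent (lie_of_at_e X).

End lie_algebra_of_lie_group.

Section smooth_End.
Context {R : realType} {n : nat} {M : manifoldType R n} {V : vectType R}.

Let b := vbasis {:V}.

(* The manifold structure of 'End(V) is given by matrices in a basis, the choice
   of which is irrelevant.  GL(V) is open in 'End(V), so for F with values in
   GL(V) this is smoothness as a map to GL(V). *)
Definition smooth_End (F : M -> 'End(V)) : Prop :=
  smooth_map (atlas M) (vec_atlas _) (fun x => passmx.mxof b b (F x)).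

Lemma smooth_End_entry F : smooth_End F ->
  forall i j, (fun x => passmx.mxof b b (F x) i j) \in smooth_fun (M := M).
Proof.
move=> [cF sF] i j; apply/smooth_funP; split=> [x|c cA k].
  apply: (@continuous_comp _ _ _ (fun x => passmx.mxof b b (F x))
    (fun A => A i j)).
    exact: cF.
  exact: coord_continuous.
have := sF c _ cA erefl k; rewrite /= preimage_setT setIT => sFc.
exact: (Ck_entry i j (open_cimg cA) sFc).
Qed.

Definition entry F (sF : smooth_End F) i j : Cinfty M :=
  MkCinfty (smooth_End_entry sF i j).

(* The differential T_p M -> T_(F p) 'End(V) = 'End(V). *)
Definition differential F (sF : smooth_End F) (p : M) (v : tangent p) :
  'End(V) := passmx.hommx b b (\matrix_(i, j) v (entry sF i j)).

End smooth_End.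

Section quasi_Frobenius.
Context {R : realType}.

Definition quasi_frobenius (q : finLieAlgType R) (beta : {biscalar q}) : Prop :=
  [/\ forall u, (forall v, beta u v = 0) -> u = 0,
      forall u v, beta u v = - beta v u &
      forall u v w,
        beta (lie u v) w + beta (lie v w) u + beta (lie w u) v = 0].

Definition Aut_qF (q : finLieAlgType R) (beta : {biscalar q}) :
  set 'End(q) := [set psi : 'End(q) |
    [/\ bijective (psi : q -> q), forall u v, psi (lie u v) = lie (psi u) (psi v) &
        forall u v, beta (psi u) (psi v) = beta u v]].

Definition g_quasi_frobenius (g : lieAlgType R) (q : finLieAlgType R)
    (beta : {biscalar q}) (rho : g -> 'End(q)) : Prop :=
  [/\ quasi_frobenius beta, linear rho,
      forall x y, rho (lie x y) = (rho x \o rho y)%VF - (rho y \o rho x)%VF,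
      forall x u v, rho x (lie u v) = lie (rho x u) v + lie u (rho x v) &
      forall x u v, beta (rho x u) v + beta u (rho x v) = 0].

(* Lie group homomorphisms G -> Aut(q, beta).  As Aut(q, beta) is embedded in
   GL(q), smoothness into it is smoothness into GL(q). *)
Record lieHomAut {n} (G : lieGroupType R n) (q : finLieAlgType R)
    (beta : {biscalar q}) := LieHomAut {
  hom_val :> G -> 'End(q);
  hom_Aut : forall a, Aut_qF beta (hom_val a);
  homM : forall a b, hom_val (a * b)%g = (hom_val a \o hom_val b)%VF;
  hom_smooth : smooth_End hom_val }.

Context {n : nat} {G : lieGroupType R n} {q : finLieAlgType R}
  {beta : {biscalar q}}.

Definition lie_differential (rho : lieHomAut G beta) : lie_of G -> 'End(q) :=
  fun x => differential (hom_smooth rho) (at_e x).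

(* G is a Lie subgroup of Aut(q, beta) through the inclusion iota when iota is
   an injective homomorphism of Lie groups which is an immersion. *)
Definition is_lie_subgroup (iota : lieHomAut G beta) : Prop :=
  injective iota /\
  forall p : G, injective (@differential _ _ _ _ _ (hom_smooth iota) p).

End quasi_Frobenius.

(* Main.v *)
(* The matrix coefficients of rho are smooth, and a tangent vector at e acts on
   them as a derivation.  Applying it to the identities
   rho_a [u, v] = [rho_a u, rho_a v] and beta (rho_a u, rho_a v) = beta (u, v),
   written in coordinates, gives the two infinitesimal conditions.  Left
   invariance turns rho_(a b) = rho_a rho_b into the statement that x maps the
   coefficient a |-> l (rho_a u) to a |-> l (rho_a (rho'_x u)), so composing the
   fields x and y composes rho'_x and rho'_y. *)

Require Import Defs.
From HB Require Import structures.
From mathcomp Require Import all_boot all_order all_algebra sesquilinear.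
From mathcomp Require Import all_classical all_reals all_analysis.

Set Implicit Arguments.
Unset Strict Implicit.

Import GRing.Theory.
Local Open Scope ring_scope.

(** [l] is left unbundled because it will be a tangent vector or a partially applied form, which
    come as plain functions with a proof of [scalar]. *)
Lemma scalar_sum {R : nzRingType} {U : lmodType R} (l : U -> R) (I : finType)
    (a : I -> R) (f : I -> U) :
  scalar l -> l (\sum_i a i *: f i) = \sum_i a i * l (f i).
Proof.
move=> hl.
pose L : {scalar U} := HB.pack l (GRing.isLinear.Build R U R _ l hl).
rewrite -[l]/(L : U -> R) linear_sum.
by apply: eq_bigr => i _; rewrite linearZ.
Qed.

Lemma scalar_coord {R : fieldType} {V : vectType R} (l : V -> R) (w : V) :
  scalar l ->
  l w = \sum_i coord (vbasis {:V}) i w * l (vbasis {:V})`_i.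
Proof.
by move=> hl; rewrite [in LHS](coord_vbasis (memvf w)) scalar_sum.
Qed.

Lemma bilinear_coord {R : fieldType} {V : vectType R} (B : V -> V -> R)
    (u v : V) (b := vbasis {:V}) :
  (forall w, scalar (B^~ w)) -> (forall w, scalar (B w)) ->
  B u v = \sum_i coord b i u * \sum_j coord b j v * B b`_i b`_j.
Proof.
move=> Bl Br; rewrite (scalar_coord _ (Bl v)).
by apply: eq_bigr => i _; rewrite (scalar_coord _ (Br _)).
Qed.

Lemma coord_vbasis_inj {R : fieldType} {V : vectType R} (u v : V) :
  (forall k, coord (vbasis {:V}) k u = coord (vbasis {:V}) k v) -> u = v.
Proof.
move=> uv; rewrite (coord_vbasis (memvf u)) (coord_vbasis (memvf v)).
by apply: eq_bigr => k _; rewrite uv.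
Qed.

Lemma Cinfty_sum {R : realType} {n : nat} {M : manifoldType R n} (I : finType)
    (f : I -> Cinfty M) (p : M) :
  (\sum_i f i) p = \sum_i f i p.
Proof. exact: (big_morph (fun g : Cinfty M => g p)). Qed.

Section tangent_vector.
Context {R : realType} {n : nat} {M : manifoldType R n} {p : M} (t : tangent p).

Lemma tangent_scalar : scalar t.
Proof. by case: t => t' /= /asboolP[]. Qed.

Lemma tangentM f g : t (f * g) = t f * g p + f p * t g.
Proof. by case: t => t' /= /asboolP[]. Qed.

Lemma tangent_cst (c : R) (h : Cinfty M) : (forall a, h a = c) -> t h = 0.
Proof.
move=> hc; have t1 : t 1 = 0.
  (* By the Leibniz rule, [t 1 = t (1 * 1) = t 1 + t 1]. *)
  apply: (addrI (t 1)); rewrite addr0 -[in RHS](mulr1 (1 : Cinfty M)) tangentM.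
  by rewrite -[(1 : Cinfty M) p]/(1 : R) mulr1 mul1r.
(* This shape matches [scalar], which is linearity on terms [a *: f + g]. *)
have -> : h = (c - 1) *: (1 : Cinfty M) + 1.
  apply/val_inj/funext => a; rewrite !CinftyE hc.
  by rewrite -[(1 : Cinfty M) a]/(1 : R) mulr1 subrK.
by rewrite tangent_scalar t1 mulr0 addr0.
Qed.

End tangent_vector.

Section coefficients.
Context {R : realType} {n : nat} {M : manifoldType R n} {V : vectType R}.
Context {F : M -> 'End(V)} (sF : smooth_End F).

Let b := vbasis {:V}.

(** Being a combination of matrix entries, this is smooth by construction. Matrices act on row
    vectors, so row [i] holds the coordinates of the image of the [i]-th basis vector. *)
Definition orbit_coord (u : V) (k : 'I_(\dim {:V})) : Cinfty M :=
  \sum_i coord b i u *: entry sF i k.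

Lemma orbit_coordE u k p : orbit_coord u k p = coord b k (F p u).
Proof.
rewrite Cinfty_sum passmx.coord_rVof (passmx.rVof_app (e := b)) ?vbasisP// mxE.
by apply: eq_bigr => i _; rewrite mxE.
Qed.

Context {p : M} (t : tangent p).

Lemma tangent_orbit_coord u k :
  t (orbit_coord u k) = coord b k (differential sF t u).
Proof.
rewrite (scalar_sum _ _ (tangent_scalar t)).
rewrite passmx.coord_rVof -passmx.rVof_mul ?vbasisP// mxE.
by apply: eq_bigr => i _; rewrite !mxE.
Qed.

(** In the basis, [h] is a combination of orbit coordinates with constant coefficients [l b_k], and
    [t] is linear. *)
Lemma tangent_linear_form (l : V -> R) (w : V) (h : Cinfty M) :
  scalar l -> (forall a, h a = l (F a w)) -> t h = l (differential sF t w).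
Proof.
move=> hl hE; have -> : h = \sum_(k < \dim {:V}) l b`_k *: orbit_coord w k.
  apply/val_inj/funext => a; rewrite !CinftyE hE Cinfty_sum (scalar_coord _ hl).
  by apply: eq_bigr => k _; rewrite !CinftyE orbit_coordE mulrC.
rewrite (scalar_sum _ _ (tangent_scalar t)).
rewrite (scalar_coord _ hl).
by apply: eq_bigr => k _; rewrite tangent_orbit_coord mulrC.
Qed.

(** In the basis, [h] is a sum of products of two orbit coordinates, so the Leibniz rule for [t]
    becomes the product rule for [B]. *)
Lemma tangent_bilinear_form (B : V -> V -> R) (u v : V) (h : Cinfty M) :
  (forall w, scalar (B^~ w)) -> (forall w, scalar (B w)) ->
  (forall a, h a = B (F a u) (F a v)) ->
  t h = B (differential sF t u) (F p v) + B (F p u) (differential sF t v).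
Proof.
move=> Bl Br hE.
(* The factor [1] only puts the sum in the form expected by [scalar_sum]. *)
have -> : h = \sum_(i < \dim {:V}) 1 *:
    (orbit_coord u i * \sum_(j < \dim {:V}) B b`_i b`_j *: orbit_coord v j).
  apply/val_inj/funext => a; rewrite !CinftyE hE Cinfty_sum bilinear_coord//.
  apply: eq_bigr => i _; rewrite !CinftyE orbit_coordE Cinfty_sum mul1r.
  congr (_ * _); apply: eq_bigr => j _.
  by rewrite !CinftyE orbit_coordE mulrC.
rewrite (scalar_sum _ _ (tangent_scalar t)).
rewrite !(@bilinear_coord _ _ B)// -big_split; apply: eq_bigr => i _ /=.
rewrite mul1r tangentM orbit_coordE Cinfty_sum tangent_orbit_coord.
rewrite (scalar_sum _ _ (tangent_scalar t)).
congr (_ * _ + _ * _).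
  by apply: eq_bigr => j _; rewrite !CinftyE orbit_coordE mulrC.
by apply: eq_bigr => j _; rewrite tangent_orbit_coord mulrC.
Qed.

End coefficients.

Section homomorphism.
Context {R : realType} {n : nat} {G : lieGroupType R n} {q : finLieAlgType R}
  {beta : {biscalar q}} (rho : lieHomAut G beta).

Let b := vbasis {:q}.
Local Notation coef := (orbit_coord (hom_smooth rho)).

(** An injective idempotent map is the identity. *)
Lemma hom1 u : rho 1%g u = u.
Proof.
have [/bij_inj inj _ _] := hom_Aut rho 1%g.
have := congr1 (fun f : 'End(q) => f u) (homM rho 1%g 1%g).
by rewrite mulg1 lfunE => /esym/inj.
Qed.

Lemma lie_of_orbit_coord (x : lie_of G) u k :
  x (coef u k) = coef (lie_differential rho x u) k.
Proof.
have [_ _ ix] := lie_ofP x.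
apply/val_inj/funext => a; rewrite !CinftyE orbit_coordE.
pose l v := coord b k (rho a v).
(* [h] is the left translate of [coef u k] by [a]: multiplicativity of [rho] makes that translate
   the fixed linear form [l] along the orbit of [u]. Left invariance then moves the evaluation from
   [a] to the identity. *)
pose h : Cinfty G := \sum_(j < \dim {:q}) l b`_j *: coef u j.
have hl : scalar l by move=> c v w; rewrite /l !linearP.
have hE c : h c = l (rho c u).
  rewrite Cinfty_sum (scalar_coord _ hl).
  by apply: eq_bigr => j _; rewrite !CinftyE orbit_coordE mulrC.
rewrite -[a in LHS]mulg1 -(ix a (coef u k) h); last first.
  by move=> c; rewrite hE orbit_coordE homM lfunE.
exact: (tangent_linear_form (hom_smooth rho) (at_e x) hl hE).
Qed.

Lemma lie_differential_coord (x : lie_of G) u k :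
  coord b k (lie_differential rho x u) = x (coef u k) 1%g.
Proof. by rewrite lie_of_orbit_coord orbit_coordE hom1. Qed.

Lemma lie_differential_linear : linear (lie_differential rho).
Proof.
move=> c x y; apply/lfunP => u; apply: coord_vbasis_inj => k.
by rewrite !lfunE/= lfunE/= linearP /= !lie_differential_coord.
Qed.

Lemma lie_differential_lie x y :
  lie_differential rho (lie x y) =
  (lie_differential rho x \o lie_differential rho y)%VF -
  (lie_differential rho y \o lie_differential rho x)%VF.
Proof.
apply/lfunP => u; apply: coord_vbasis_inj => k.
rewrite !lfunE/= lfunE/= !lfunE/= lfunE/= linearB /= !lie_differential_coord.
(* The right side becomes [x (y (coef u k)) - y (x (coef u k))] at the identity, which is the
   bracket of fields by definition. *)
by rewrite -!lie_of_orbit_coord.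
Qed.

Lemma lie_differential_derivation x u v :
  lie_differential rho x (lie u v) =
  lie (lie_differential rho x u) v + lie u (lie_differential rho x v).
Proof.
apply: coord_vbasis_inj => k; rewrite linearD /= lie_differential_coord.
(* The product rule is applied to one coordinate of the bracket, an ordinary bilinear form. *)
have := @tangent_bilinear_form _ _ _ _ _ (hom_smooth rho) _ (at_e x)
  (fun u v => coord b k (lie u v)) u v (coef (lie u v) k).
rewrite !hom1; apply.
- by move=> w c u' v'; rewrite lie_linearl linearP.
- by move=> w c u' v'; rewrite lie_linearr linearP.
- by move=> a; have [_ hlie _] := hom_Aut rho a; rewrite orbit_coordE hlie.
Qed.

Lemma lie_differential_skew x u v :
  beta (lie_differential rho x u) v + beta u (lie_differential rho x v) = 0.
Proof.
(* By invariance of [beta], this constant function is also [beta (rho a u) (rho a v)]; its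
   derivative is computed in both ways. *)
pose h : Cinfty G := beta u v *: (1 : Cinfty G).
have hE a : h a = beta u v by rewrite -[LHS]/(_ * 1) mulr1.
rewrite -(tangent_cst (at_e x) hE).
rewrite (@tangent_bilinear_form _ _ _ _ _ (hom_smooth rho) _ (at_e x)
  (fun u v => beta u v) u v).
- by rewrite !hom1.
- by move=> w c u' v'; rewrite linearPl.
- by move=> w c u' v'; rewrite linearPr.
- by move=> a; have [_ _ hb] := hom_Aut rho a; rewrite hE hb.
Qed.

End homomorphism.

Theorem proposition3p3 (R : realType) (q : finLieAlgType R)
    (beta : {biscalar q}) (hq : quasi_frobenius beta)
    (n : nat) (G : lieGroupType R n) :
  (forall rho : lieHomAut G beta,
     g_quasi_frobenius beta (lie_differential rho)) /\
  (forall iota : lieHomAut G beta, is_lie_subgroup iota ->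
     exists2 rho' : lie_of G -> 'End(q),
       rho' = lie_differential iota & g_quasi_frobenius beta rho').
Proof.
have hrho (rho : lieHomAut G beta) :
    g_quasi_frobenius beta (lie_differential rho).
  split=> //.
  - exact: lie_differential_linear.
  - exact: lie_differential_lie.
  - exact: lie_differential_derivation.
  - exact: lie_differential_skew.
by split=> // iota _; exists (lie_differential iota).
Qed.
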